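(* Let $n\ge1$ be an integer and, for $f\in C(\overline\Omega)$, define $$\mathcal I_n^* f(\mathbf t)=\sum_{\mathbf j\in\mathbb H_n^*}f(\tfrac{\mathbf j}{n})\,\ell_{\mathbf j,n}(\mathbf t),\qquad \ell_{\mathbf j,n}(\mathbf t)=\Phi_n^*(\mathbf t-\tfrac{\mathbf j}{n}),\qquad \Phi_n^*(\mathbf t)=\frac1{3n^2}\sum_{\mathbf j\in\mathbb H_n^*}c_{\mathbf j}^{(n)}\phi_{\mathbf j}(\mathbf t).$$ Then $\mathcal I_n^*f\in\mathcal H_n^*:=\mathrm{span}\{\phi_{\mathbf j}:\mathbf j\in\mathbb H_n^*\}$ and $$\mathcal I_n^*f(\tfrac{\mathbf j}{n})=\begin{cases}f(\tfrac{\mathbf j}{n}),&\mathbf j\in\mathbb H_n^\circ,\\ \sum_{\mathbf k\in\mathcal S_{\mathbf j}}f(\tfrac{\mathbf k}{n}),&\mathbf j\in\partial\mathbb H_n^*.\end{cases}$$ Furthermore, $\Phi_n^*$ is a real function and has the compact formula $$\Phi_n^*(\mathbf t)=\frac1{3n^2}\Big[\tfrac12\big(\Theta_n(\mathbf t)-\Theta_{n-2}(\mathbf t)\big)-\tfrac13\big(\cos\tfrac{2n\pi}{3}(t_1-t_2)+\cos\tfrac{2n\pi}{3}(t_2-t_3)+\cos\tfrac{2n\pi}{3}(t_3-t_1)\big)\Big],$$ where $$\Theta_n(\mathbf t)=\frac{\sin\frac{(n+1)\pi(t_1-t_2)}{3}\,\sin\frac{(n+1)\pi(t_2-t_3)}{3}\,\sin\frac{(n+1)\pi(t_3-t_1)}{3}}{\sin\frac{\pi(t_1-t_2)}{3}\,\sin\frac{\pi(t_2-t_3)}{3}\,\sin\frac{\pi(t_3-t_1)}{3}}$$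 (extended by continuity where the denominator vanishes).
   Context: $\mathbb R^3_H=\{\mathbf t=(t_1,t_2,t_3)\in\mathbb R^3:t_1+t_2+t_3=0\}$, $\mathbb H=\mathbb Z^3\cap\mathbb R^3_H$. The closed hexagon is $\overline\Omega=\{\mathbf t\in\mathbb R^3_H:-1\le t_1,t_2,t_3\le1\}$. For $\mathbf j\in\mathbb H$, $\phi_{\mathbf j}(\mathbf t)=e^{\frac{2\pi i}{3}\mathbf j\cdot\mathbf t}$. $\mathbb H_n^*=\{\mathbf j\in\mathbb H:-n\le j_1,j_2,j_3\le n\}$, $\mathbb H_n^\circ=\{\mathbf j\in\mathbb H:-n<j_1,j_2,j_3<n\}$, $\partial\mathbb H_n^*=\mathbb H_n^*\setminus\mathbb H_n^\circ$. Weights: $c_{\mathbf j}^{(n)}=1$ if $\mathbf j\in\mathbb H_n^\circ$; $\frac12$ if $\mathbf j\in\partial\mathbb H_n^*$ and $j_1j_2j_3\ne0$; $\frac13$ if $\mathbf j\in\partial\mathbb H_n^*$ and $j_1j_2j_3=0$. For $\mathbf t,\mathbf s\in\mathbb R_H^3$, $\mathbf t\equiv\mathbf s\bmod 3$ means $t_1-s_1\equiv t_2-s_2\equiv t_3-s_3\pmod 3$ (i.e. the differences of these three numbers lie in $3\mathbb Z$). For $\mathbf j\in\partial\mathbb H_n^*$, $\mathcal S_{\mathbf j}=\{\mathbf k\in\mathbb H_n^*:\tfrac{\mathbf k}{n}\equiv\tfrac{\mathbf j}{n}\bmod 3\}$. *)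

(* Defs.v *)
From HB Require Import structures.
From mathcomp Require Import all_boot all_order all_algebra.
From mathcomp Require Import complex.
From mathcomp Require Import all_classical all_reals all_analysis.

Set Implicit Arguments.
Unset Strict Implicit.
Unset Printing Implicit Defensive.

Import Order.TTheory GRing.Theory Num.Theory.
Import numFieldNormedType.Exports.

Local Open Scope classical_set_scope.
Local Open Scope ring_scope.

(* The homogeneous coordinates (t_1, t_2, t_3) are the entries
   t 0 0, t 0 1, t 0 2 of a row vector. *)

Definition R3H (R : realType) : set 'rV[R]_3 :=
  [set t | t 0 0 + t 0 1 + t 0 2 = 0].

Definition hexagon (R : realType) : set 'rV[R]_3 :=
  [set t | R3H t /\ forall i, -1 <= t 0 i <= 1].

Definition HH : set 'rV[int]_3 := [set j | j 0 0 + j 0 1 + j 0 2 = 0].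

Definition Hstar (n : nat) : set 'rV[int]_3 :=
  [set j | HH j /\ forall i, - n%:Z <= j 0 i <= n%:Z].

Definition Hcirc (n : nat) : set 'rV[int]_3 :=
  [set j | HH j /\ forall i, - n%:Z < j 0 i < n%:Z].

Definition Hbound (n : nat) : set 'rV[int]_3 := Hstar n `\` Hcirc n.

(* The grid point j / n. *)
Definition node (R : realType) (n : nat) (j : 'rV[int]_3) : 'rV[R]_3 :=
  \row_i ((j 0 i)%:~R / n%:R).

Definition cexp (R : realType) (z : R[i]) : R[i] :=
  let: Complex x y := z in Complex (expR x * cos y) (expR x * sin y).

Definition dotp (R : realType) (j : 'rV[int]_3) (t : 'rV[R]_3) : R :=
  \sum_(i < 3) (j 0 i)%:~R * t 0 i.

Definition phi (R : realType) (j : 'rV[int]_3) (t : 'rV[R]_3) : R[i] :=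
  cexp (Complex 0 (2 * pi / 3 * dotp j t)).

(* Only meaningful, and only used, for j in Hstar n. *)
Definition weight (R : realType) (n : nat) (j : 'rV[int]_3) : R :=
  if j \in Hcirc n then 1
  else if j 0 0 * j 0 1 * j 0 2 != 0 then 1 / 2 else 1 / 3.

(* The three differences t_i - s_i are congruent to one another modulo 3;
   they need not themselves be multiples of 3. *)
Definition eqmod3 (R : realType) (t s : 'rV[R]_3) : Prop :=
  forall i k : 'I_3, exists m : int,
    (t 0 i - s 0 i) - (t 0 k - s 0 k) = 3 * m%:~R.

Definition Sset (R : realType) (n : nat) (j : 'rV[int]_3) : set 'rV[int]_3 :=
  [set k | Hstar n k /\ eqmod3 (node R n k) (node R n j)].

(* The sums over Hstar n and over its subsets are finitely supported sums over
   classical sets; these sets are finite, so they are the usual finite sums. *)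
Definition Phistar (R : realType) (n : nat) (t : 'rV[R]_3) : R[i] :=
  (3 * n%:R ^+ 2)^-1 *
  \sum_(j \in Hstar n) real_complex R (weight R n j) * phi j t.

Definition ell (R : realType) (n : nat) (j : 'rV[int]_3) (t : 'rV[R]_3) : R[i] :=
  Phistar n (t - node R n j).

Definition interp (R : realType) (n : nat) (f : 'rV[R]_3 -> R[i])
    (t : 'rV[R]_3) : R[i] :=
  \sum_(j \in Hstar n) f (node R n j) * ell n j t.

(* Membership in the complex span of the phi_j, j in Hstar n, as functions on
   R3H. *)
Definition in_Hspan (R : realType) (n : nat) (g : 'rV[R]_3 -> R[i]) : Prop :=
  exists a : 'rV[int]_3 -> R[i], forall t, R3H t ->
    g t = \sum_(j \in Hstar n) a j * phi j t.

(* The index is an integer because n - 2 = -1 occurs when n = 1. *)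
Definition theta_num (R : realType) (m : int) (t : 'rV[R]_3) : R :=
  sin ((m + 1)%:~R * pi * (t 0 0 - t 0 1) / 3) *
  sin ((m + 1)%:~R * pi * (t 0 1 - t 0 2) / 3) *
  sin ((m + 1)%:~R * pi * (t 0 2 - t 0 0) / 3).

Definition theta_den (R : realType) (t : 'rV[R]_3) : R :=
  sin (pi * (t 0 0 - t 0 1) / 3) *
  sin (pi * (t 0 1 - t 0 2) / 3) *
  sin (pi * (t 0 2 - t 0 0) / 3).

(* Where the denominator vanishes, the value is the limit of the quotient
   along the points of R3H at which it is defined. *)
Definition Theta (R : realType) (m : int) (t : 'rV[R]_3) : R :=
  if theta_den t != 0 then theta_num m t / theta_den t
  else lim ((theta_num m s / theta_den s)
            @[s --> within [set s | R3H s /\ theta_den s != 0] (nbhs t)]).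

(* Main.v *)
Require Import Defs.
From HB Require Import structures.
From mathcomp Require Import all_boot all_order all_algebra.
From mathcomp Require Import complex.
From mathcomp Require Import all_classical all_reals all_analysis.
From mathcomp Require Import ring lra zify.
Set Implicit Arguments.
Unset Strict Implicit.
Unset Printing Implicit Defensive.
Import Order.TTheory GRing.Theory Num.Theory.
Import numFieldNormedType.Exports.
Local Open Scope classical_set_scope.
Local Open Scope ring_scope.

(** The hexagonal Dirichlet kernel is a difference of products of one-variable
kernels, and everything follows from that.

Put A = pi (t1 - t2) / 3, B = pi (t2 - t3) / 3, C = pi (t3 - t1) / 3, so that
A + B + C = 0.  Each factor sin (N A) / sin A of the Theta quotient is the
trigonometric polynomial [chebU N A] = sum_(k < N) exp (i (N - 1 - 2 k) A).
Hence Theta_(N-1) extends continuously to [hexU N], a product of three such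
factors ([Theta_hexU]; the limit in the definition of Theta makes sense
because the singular lines have dense complement in the plane,
[R3H_within_regular]).  Expanding the product and using A + B + C = 0 turns
[hexU N] into the sum of phi_(c-a, a-b, b-c) over the cube of triples
(a, b, c) with entries below N ([hexU_cube]).  A difference vector
(c-a, a-b, b-c) determines the triple up to a diagonal translation, so the
triples whose largest entry is n correspond bijectively to the hexagon H_n^*
([shell_bij]); therefore the sum of the phi_j over H_n^* is
[hexU n.+1 - hexU n].

The weight c_j is half the indicator of H_n^*, plus half the indicator of
H_n^o = H_(n-1)^*, minus one sixth of the indicator of the six vertices
([weightE]).  The two hexagons give (Theta_n - Theta_(n-2)) / 2 by
telescoping, and the vertices, which pair up into opposite points, give the
three cosines.  This is the compact formula [Phistar_hexU], and it shows that
the kernel is real.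

The interpolation property is the statement that the kernel at a difference of
two nodes is 1 if the nodes are congruent mod 3 and 0 otherwise.  It is read
off from the compact formula ([node_kernel]).  At such a point n A, n B and
n C are integer multiples of pi / 3, congruent to one another modulo pi.
Either all three are multiples of pi, and then each factor of the product is
explicit up to sign; or sin^2 (n A) = sin^2 (n B) = sin^2 (n C) = 3/4, and
then the value follows from the identity
cot A cot B + cot B cot C + cot C cot A = 1.
The nodes are congruent exactly when sin A = sin B = sin C = 0.  Finally the
only node of the hexagon congruent to an interior one is itself
([Sset_interior]). *)

(** * The Dirichlet kernel sin (N x) / sin x *)

Lemma sin_intpi (R : realType) (m : int) : sin (m%:~R * pi) = 0 :> R.
Proof.
have H (k : nat) : sin (k%:R * pi) = 0 :> R.
  elim: k => [|k IH]; first by rewrite mul0r sin0.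
  by rewrite -natr1 mulrDl mul1r sinDpi IH oppr0.
case: m => k; first exact: H.
by rewrite NegzE mulrNz mulNr sinN -pmulrn H oppr0.
Qed.

Lemma sin_eq0P (R : realType) (x : R) :
  reflect (exists m : int, x = m%:~R * pi) (sin x == 0).
Proof.
apply: (iffP eqP) => [sx0|[m ->]]; last exact: sin_intpi.
have pi0 := @pi_gt0 R.
set m := Num.floor (x / pi); exists m; apply/eqP; rewrite -subr_eq0.
set y := x - _; have sy0 : sin y = 0.
  by rewrite /y sinB sx0 sin_intpi mul0r mulr0 subrr.
have yge0 : 0 <= y.
  by rewrite subr_ge0 -ler_pdivlMr// floor_le.
have yltpi : y < pi.
  rewrite ltrBlDr -[X in X + _]mul1r -mulrDl -ltr_pdivrMr// addrC.
  by have := floorD1_gt (x / pi); rewrite intrD.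
rewrite eq_le yge0 andbT leNgt; apply/negP => y0.
by have := @sin_gt0_pi _ y; rewrite sy0 ltxx y0 yltpi => /(_ isT).
Qed.

(** The Chebyshev polynomial of the second kind U_(N-1) at cos x.  The cosine
form is real and defined everywhere; [chebU_expi] gives the exponential
form. *)
Definition chebU (R : realType) (N : nat) (x : R) : R :=
  \sum_(k < N) cos ((N%:R - 1 - 2 * k%:R) * x).

(** The product 2 sin x cos y is a difference of sines, so the sum
telescopes. *)
Lemma sin_chebU (R : realType) (N : nat) (x : R) :
  sin x * chebU N x = sin (N%:R * x).
Proof.
suff : 2 * (sin x * chebU N x) = 2 * sin (N%:R * x) by lra.
rewrite /chebU !mulr_sumr.
pose f (k : nat) := - sin ((N%:R - 2 * k%:R) * x).
transitivity (\sum_(0 <= k < N) (f k.+1 - f k)).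
  rewrite big_mkord; apply: eq_bigr => k _; rewrite /f.
  have -> : (N%:R - 2 * k.+1%:R) * x = (N%:R - 1 - 2 * k%:R) * x - x.
    by rewrite -natr1; ring.
  have -> : (N%:R - 2 * k%:R) * x = (N%:R - 1 - 2 * k%:R) * x + x by ring.
  by rewrite sinB sinD; ring.
rewrite telescope_sumr// /f.
have -> : (N%:R - 2 * N%:R) * x = - (N%:R * x) by ring.
have -> : (N%:R - 2 * 0%:R) * x = N%:R * x by ring.
by rewrite sinN; ring.
Qed.

(** At a multiple of pi the angles of all summands differ by multiples of
2 pi. *)
Lemma chebU_sin0 (R : realType) (N : nat) (x : R) :
  sin x = 0 -> chebU N x = N%:R * cos ((N%:R - 1) * x).
Proof.
move=> /eqP/sin_eq0P [m xE].
rewrite /chebU (eq_bigr (fun=> cos ((N%:R - 1) * x))).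
  by rewrite sumr_const card_ord mulr_natl.
move=> k _; set y := k%:R * x.
have sy0 : sin y = 0.
  apply/eqP/sin_eq0P; exists (k%:Z * m).
  by rewrite /y xE intrM -pmulrn mulrA.
have -> : (N%:R - 1 - 2 * k%:R) * x = (N%:R - 1) * x - (y + y) by rewrite /y; ring.
rewrite cosB cosD sinD sy0.
have := cos2Dsin2 y; rewrite sy0 => cy2.
rewrite !(mulr0, mul0r, addr0, subr0) -expr2.
by move: cy2; rewrite expr0n addr0 => ->; rewrite mulr1.
Qed.

(** * The kernel at differences of nodes *)

Lemma sin_chebU_succ (R : realType) (n : nat) (x : R) :
  sin x * chebU n.+1 x = sin (n%:R * x) * cos x + cos (n%:R * x) * sin x.
Proof. by rewrite sin_chebU -natr1 mulrDl mul1r sinD. Qed.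

Lemma sin_chebU_pred (R : realType) (n : nat) (x : R) : (1 <= n)%N ->
  sin x * chebU n.-1 x = sin (n%:R * x) * cos x - cos (n%:R * x) * sin x.
Proof.
move=> hn; rewrite sin_chebU -sinB; congr sin.
by rewrite -{2}(prednK hn) -natr1; ring.
Qed.

Lemma cos2_sin0 (R : realType) (x y : R) :
  sin x = 0 -> cos (y + (x + x)) = cos y.
Proof.
move=> sx0; rewrite (cosD y) cosD sinD sx0.
have : cos x * cos x = 1 by have := cos2Dsin2 x; rewrite sx0; lra.
by move=> ->; rewrite !(mulr0, mul0r, addr0, subr0) mulr1.
Qed.

(** The one-variable kernels of indices n + 1 and n - 1 at a zero of sin (n x):
the addition formulas give opposite values when sin x does not vanish, and the
second alternative covers the removable singularities. *)
Lemma chebU_sin_nx0 (R : realType) (n : nat) (x : R) : (1 <= n)%N ->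
  sin (n%:R * x) = 0 ->
  (sin x != 0 -> chebU n.+1 x = cos (n%:R * x) /\
                 chebU n.-1 x = - cos (n%:R * x))
  /\ (sin x = 0 -> chebU n.+1 x = (n%:R + 1) * cos (n%:R * x) /\
                   chebU n.-1 x = (n%:R - 1) * cos (n%:R * x)).
Proof.
move=> hn snx; split => sx.
  split; apply: (mulfI sx).
    by rewrite sin_chebU_succ snx mul0r add0r mulrC.
  by rewrite sin_chebU_pred// snx mul0r add0r mulrN mulrC.
rewrite !chebU_sin0// natr1; split.
  by rewrite -natr1 addrK.
have -> : n.-1%:R = n%:R - 1 :> R by rewrite -{2}(prednK hn) -natr1 addrK.
rewrite -[in RHS](@cos2_sin0 _ (- x) (n%:R * x)) ?sinN ?sx ?oppr0//.
by congr (_ * cos _); ring.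
Qed.

(** The products of the kernels of indices n + 1 and n - 1 at points where
sin (n A) = sin (n B) = sin (n C) = 0.  The cosines [ca], [cb], [cc] of n A, n B, n C are signs with
product 1, so each product loses its signs.  With no removable singularity the
difference is 1 - (-1), with one it is (N + 1) - (N - 1), with three it is
(N + 1)^3 - (N - 1)^3; exactly two cannot occur because A + B + C = 0. *)
Lemma hexU_diff_sin0 (R : realType) (N ca cb cc sA cA sB cB sC : R)
    (u u' v v' w w' : R) :
  ca * cb * cc = 1 ->
  sA ^+ 2 + cA ^+ 2 = 1 -> sB ^+ 2 + cB ^+ 2 = 1 -> sC = - (sA * cB + cA * sB) ->
  (sA != 0 -> u = ca /\ u' = - ca) /\
    (sA = 0 -> u = (N + 1) * ca /\ u' = (N - 1) * ca) ->
  (sB != 0 -> v = cb /\ v' = - cb) /\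
    (sB = 0 -> v = (N + 1) * cb /\ v' = (N - 1) * cb) ->
  (sC != 0 -> w = cc /\ w' = - cc) /\
    (sC = 0 -> w = (N + 1) * cc /\ w' = (N - 1) * cc) ->
  u * v * w - u' * v' * w' =
  if [&& sA == 0, sB == 0 & sC == 0] then 6 * N ^+ 2 + 2 else 2.
Proof.
move=> key pA pB SC hA hB hC.
have fac (S c z z' : R) :
    (S != 0 -> z = c /\ z' = - c) /\
    (S = 0 -> z = (N + 1) * c /\ z' = (N - 1) * c) ->
    exists p p', [/\ z = p * c, z' = p' * c &
      if S == 0 then p = N + 1 /\ p' = N - 1 else p = 1 /\ p' = -1].
  move=> [h0 h1]; have [S0|S0] := eqVneq S 0.
    by have [-> ->] := h1 S0; exists (N + 1), (N - 1).
  by have [-> ->] := h0 S0; exists 1, (-1); rewrite mul1r mulN1r.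
have [p [p' [-> -> hp]]] := fac _ _ _ _ hA.
have [q [q' [-> -> hq]]] := fac _ _ _ _ hB.
have [r [r' [-> -> hr]]] := fac _ _ _ _ hC.
have -> : (p * ca) * (q * cb) * (r * cc) - (p' * ca) * (q' * cb) * (r' * cc) =
    p * q * r - p' * q' * r'.
  by rewrite -[p * q * r]mulr1 -[p' * q' * r']mulr1 -key; ring.
move: hp hq hr.
have nz (x y : R) : x ^+ 2 + y ^+ 2 = 1 -> x = 0 -> y != 0.
  by move=> + x0; rewrite x0; apply: contra_eq_neq => ->; rewrite !expr0n /=
    addr0 eq_sym oner_neq0.
have [sA0|sA0] := eqVneq sA 0; have [sB0|sB0] := eqVneq sB 0;
have [sC0|sC0] := eqVneq sC 0; rewrite ?andbT ?andbF /=
 => -[-> ->] [-> ->] [-> ->]; try by ring.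
- by move: sC0; rewrite SC sA0 sB0 mul0r mulr0 addr0 oppr0 eqxx.
- move: SC sB0; rewrite sC0 sA0 mul0r add0r => /esym/eqP.
  by rewrite oppr_eq0 mulf_eq0 (negPf (nz _ _ pA sA0)) /= => ->.
- move: SC sA0; rewrite sC0 sB0 mulr0 addr0 => /esym/eqP.
  by rewrite oppr_eq0 mulf_eq0 (negPf (nz _ _ pB sB0)) orbF => ->.
Qed.

(** Three angles with sum 0 that agree modulo pi but are not multiples of pi
have common tangent +- sqrt 3: the sum condition is
3 tan x - tan^3 x = 0. *)
Lemma sin_cos_third (R : realType) (sa ca sb cb sc cc : R) :
  sa != 0 -> sa * cb = ca * sb -> sb * cc = cb * sc ->
  sc = - (sa * cb + ca * sb) -> cc = ca * cb - sa * sb ->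
  sa ^+ 2 + ca ^+ 2 = 1 -> sb ^+ 2 + cb ^+ 2 = 1 ->
  sc ^+ 2 + cc ^+ 2 = 1 ->
  [/\ sb != 0, sc != 0,
   sa ^+ 2 = 3 / 4, sb ^+ 2 = 3 / 4 & sc ^+ 2 = 3 / 4] /\
   [/\ ca * cb * cc = - (1 / 8), sa * sb = 3 * (ca * cb),
   sb * sc = 3 * (cb * cc) & sa * sc = 3 * (ca * cc)].
Proof.
move=> sa0 hab hbc hC hcC qa qb qc.
have sb0 : sb != 0.
  apply/eqP => sb0; move: hab qb; rewrite sb0 mulr0 => /eqP.
  by rewrite mulf_eq0 (negPf sa0) /= => /eqP ->; rewrite !expr0n /=; lra.
have hsc : sc = - 2 * (cb * sa) by rewrite hC -hab; ring.
have hsc' : sc = - 2 * (ca * sb) by rewrite hC hab; ring.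
have hac : sa * sb = 3 * (ca * cb).
  have : sb * (sa * sb - 3 * (ca * cb)) = 0.
    have : sb * (ca * cb - sa * sb) = cb * (- 2 * (ca * sb)) by rewrite -hcC hbc hsc'.
    by lra.
  by move/eqP; rewrite mulf_eq0 (negPf sb0) /= => /eqP; lra.
have hcc : cc = - 2 * (ca * cb) by rewrite hcC hac; ring.
have tb : sb ^+ 2 = 3 * cb ^+ 2.
  apply: (mulfI sa0).
  transitivity (sb * (sa * sb)); first by ring.
  rewrite hac; transitivity (3 * cb * (ca * sb)); first by ring.
  by rewrite -hab; ring.
have ta : sa ^+ 2 = 3 * ca ^+ 2.
  apply: (mulfI sb0).
  transitivity (sa * (sa * sb)); first by ring.
  rewrite hac; transitivity (3 * ca * (sa * cb)); first by ring.
  by rewrite hab; ring.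
have ca2 : ca ^+ 2 = 1 / 4 by lra.
have cb2 : cb ^+ 2 = 1 / 4 by lra.
have sa2 : sa ^+ 2 = 3 / 4 by lra.
have sb2 : sb ^+ 2 = 3 / 4 by lra.
have sc2 : sc ^+ 2 = 3 / 4 by rewrite hsc !exprMn cb2 sa2; field.
split; split=> //.
- by apply/eqP => sc0; move: sc2; rewrite sc0 expr0n /=; lra.
- rewrite hcc; transitivity (- 2 * (ca ^+ 2 * cb ^+ 2)); first by ring.
  by rewrite ca2 cb2; field.
- rewrite hsc hcc; transitivity (- 2 * cb * (sa * sb)); first by ring.
  by rewrite hac; ring.
- rewrite hsc' hcc; transitivity (- 2 * ca * (sa * sb)); first by ring.
  by rewrite hac; ring.
Qed.

(** The compact formula evaluated at a difference of nodes.  The two sine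
conditions say that n A, n B, n C agree modulo pi. *)
Lemma node_kernel (R : realType) (n : nat) (A B C : R) : (1 <= n)%N ->
  A + B + C = 0 ->
  sin (n%:R * A - n%:R * B) = 0 -> sin (n%:R * B - n%:R * C) = 0 ->
  1 / 2 * (chebU n.+1 A * chebU n.+1 B * chebU n.+1 C
           - chebU n.-1 A * chebU n.-1 B * chebU n.-1 C)
  - 1 / 3 * (cos (2 * (n%:R * A)) + cos (2 * (n%:R * B)) + cos (2 * (n%:R * C)))
  = if [&& sin A == 0, sin B == 0 & sin C == 0] then 3 * n%:R ^+ 2 else 0.
Proof.
move=> hn ABC; rewrite !sinB => /eqP; rewrite subr_eq0 => /eqP hab /eqP.
rewrite subr_eq0 => /eqP hbc.
have CE : C = - (A + B) by lra.
have cE : n%:R * C = - (n%:R * A + n%:R * B) by rewrite CE; ring.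
have dbl (y : R) : cos (2 * y) = 1 - 2 * sin y ^+ 2.
  have -> : 2 * y = y + y by ring.
  by rewrite cosD; have := cos2Dsin2 y; lra.
have pyth (y : R) : sin y ^+ 2 + cos y ^+ 2 = 1 by rewrite addrC cos2Dsin2.
have hC : sin (n%:R * C) = - (sin (n%:R * A) * cos (n%:R * B)
                              + cos (n%:R * A) * sin (n%:R * B)).
  by rewrite cE sinN sinD.
have hcC : cos (n%:R * C) = cos (n%:R * A) * cos (n%:R * B)
                              - sin (n%:R * A) * sin (n%:R * B).
  by rewrite cE cosN cosD.
have SC : sin C = - (sin A * cos B + cos A * sin B) by rewrite CE sinN sinD.
have CC : cos C = cos A * cos B - sin A * sin B by rewrite CE cosN cosD.
rewrite !dbl.
have [sa0|sa0] := eqVneq (sin (n%:R * A)) 0.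
  have ca0 : cos (n%:R * A) != 0.
    by apply/eqP => H; have := pyth (n%:R * A); rewrite H sa0 !expr0n /=; lra.
  have sb0 : sin (n%:R * B) = 0.
    by apply: (mulfI ca0); rewrite -hab sa0 mul0r mulr0.
  have sc0 : sin (n%:R * C) = 0 by rewrite hC sa0 sb0 mul0r mulr0 addr0 oppr0.
  rewrite (hexU_diff_sin0 _ (pyth A) (pyth B) SC (chebU_sin_nx0 hn sa0)
    (chebU_sin_nx0 hn sb0) (chebU_sin_nx0 hn sc0)).
    rewrite sa0 sb0 sc0.
    by case: ifP => _; rewrite expr0n /=; move: (n%:R : R) => N; field.
  rewrite hcC sa0 mul0r subr0 -expr2 exprMn.
  have := pyth (n%:R * A); have := pyth (n%:R * B); rewrite sa0 sb0 expr0n !add0r.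
  by move=> -> ->; rewrite mulr1.
have [[sb0 sc0 sa2 sb2 sc2] [ccc hsab hsbc hsac]] :=
  sin_cos_third sa0 hab hbc hC hcC (pyth _) (pyth _) (pyth _).
have nz (y : R) : sin (n%:R * y) != 0 -> sin y != 0.
  by apply: contra_neq => H; rewrite -sin_chebU H mul0r.
have [[SA0 SB0] SC0] := (nz _ sa0, nz _ sb0, nz _ sc0).
rewrite (negPf SA0) /=.
suff -> : chebU n.+1 A * chebU n.+1 B * chebU n.+1 C
         - chebU n.-1 A * chebU n.-1 B * chebU n.-1 C = -1.
  by rewrite sa2 sb2 sc2; field.
(* Clearing sin A sin B sin C replaces the kernels by the addition formulas. *)
apply: (mulfI (mulf_neq0 (mulf_neq0 SA0 SB0) SC0)).
transitivity (
  (sin A * chebU n.+1 A) * (sin B * chebU n.+1 B) * (sin C * chebU n.+1 C)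
  - (sin A * chebU n.-1 A) * (sin B * chebU n.-1 B) * (sin C * chebU n.-1 C)).
  by ring.
rewrite !sin_chebU_succ !sin_chebU_pred//.
(* The cotangent identity, which is sin (A + B + C) = 0 expanded. *)
have cot : sin A * cos B * cos C + sin B * cos A * cos C
    + sin C * cos A * cos B = sin A * sin B * sin C.
  by rewrite SC CC; ring.
move: (sin (n%:R * A)) (cos (n%:R * A)) (sin (n%:R * B)) (cos (n%:R * B))
      (sin (n%:R * C)) (cos (n%:R * C)) ccc hsab hsbc hsac
      => sa ca sb cb sc cc ccc hsab hsbc hsac.
transitivity (2 * ((ca * cb * cc) * (sin A * sin B * sin C)
  + ca * (sb * sc) * sin A * cos B * cos C
  + cb * (sa * sc) * sin B * cos A * cos C
  + cc * (sa * sb) * sin C * cos A * cos B)); first by ring.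
rewrite hsbc hsac hsab.
transitivity (2 * (ca * cb * cc) * (sin A * sin B * sin C + 3 *
  (sin A * cos B * cos C + sin B * cos A * cos C + sin C * cos A * cos B))).
  by ring.
by rewrite cot ccc; field.
Qed.

(** * The continuous extension of Theta *)

Lemma continuous_chebU (R : realType) (N : nat) : continuous (@chebU R N).
Proof.
move=> x; apply: cvg_big => [|k _]; first exact: add_continuous.
apply: continuous_comp; last exact: continuous_cos.
by apply: cvgM; [exact: cvg_cst|exact: cvg_id].
Qed.

(** The product of the three one-variable kernels; by [Theta_hexU] it is
Theta_(N-1), singular lines included. *)
Definition hexU (R : realType) (N : nat) (t : 'rV[R]_3) : R :=
  chebU N (pi * (t 0 0 - t 0 1) / 3) * chebU N (pi * (t 0 1 - t 0 2) / 3)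
  * chebU N (pi * (t 0 2 - t 0 0) / 3).

Lemma theta_num_hexU (R : realType) (m : int) (N : nat) (t : 'rV[R]_3) :
  m + 1 = N%:Z -> theta_num m t = theta_den t * hexU N t.
Proof.
move=> mN; rewrite /theta_num /theta_den mN -pmulrn.
have E (d : R) : N%:R * pi * d / 3 = N%:R * (pi * d / 3) by ring.
by rewrite !E -!sin_chebU /hexU; ring.
Qed.

Lemma continuous_hexU (R : realType) (N : nat) : continuous (@hexU R N).
Proof.
have D (i j : 'I_3) : continuous (fun t : 'rV[R]_3 => t 0 i - t 0 j).
  move=> t.
  by apply: (@continuousB _ _ _ (fun t : 'rV[R]_3 => t 0 i) (fun t => t 0 j));
    exact: coord_continuous.
have C (i j : 'I_3) :
    continuous (fun t : 'rV[R]_3 => chebU N (pi * (t 0 i - t 0 j) / 3)).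
  have scaled : continuous (fun x : R => chebU N (pi * x / 3)).
    move=> x; apply: (continuous_comp (f := fun x : R => pi * x / 3));
      last exact: continuous_chebU.
    apply: cvgM; last exact: cvg_cst.
    by apply: cvgM; [exact: cvg_cst|exact: cvg_id].
  move=> t.
  exact: (continuous_comp (f := fun t : 'rV[R]_3 => t 0 i - t 0 j)
    (D i j t) (scaled _)).
by move=> t; apply: continuousM (C 2 0 t); exact: (continuousM (C 0 1 t) (C 1 2 t)).
Qed.

(** Zeros of the sine are isolated; near a zero x, sin (x + h) is
+- sin h. *)
Lemma near_sin_affine_neq0 (R : realType) (x c : R) : c != 0 ->
  \forall e \near 0^'+, sin (x + c * e) != 0.
Proof.
move=> c0; have [sx0|sx0] := eqVneq (sin x) 0; last first.
  apply: (@cvgr_neq0 _ _ _ _ _ (fun e : R => sin (x + c * e)) (sin x)) => //.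
  apply: cvg_at_right_filter.
  rewrite -[X in _ --> sin X]addr0 -[X in _ --> sin (_ + X)](mulr0 c).
  apply: (continuous_comp (f := fun e : R => x + c * e)); last exact: continuous_sin.
  apply: cvgD; first exact: cvg_cst.
  by apply: cvgM; [exact: cvg_cst|exact: cvg_id].
near=> e; have e0 : 0 < e by near: e; exact: nbhs_right_gt.
have epi : e < pi / `|c|.
  by near: e; apply: nbhs_right_lt; rewrite divr_gt0 ?pi_gt0 ?normr_gt0.
rewrite sinD sx0 mul0r add0r mulf_neq0//.
  by rewrite -normr_gt0 sin0cos1 ?sx0.
have : sin (`|c| * e) != 0.
  apply: lt0r_neq0; apply: sin_gt0_pi; rewrite mulr_gt0 ?normr_gt0//=.
  by rewrite mulrC -ltr_pdivlMr// normr_gt0.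
by case: ger0P => //; rewrite mulNr sinN oppr_eq0.
Unshelve. all: by end_near. Qed.

(** The regular points are dense in the plane, so that the limit defining
Theta at a singular point is determined. *)
Lemma R3H_within_regular (R : realType) (t : 'rV[R]_3) : R3H t ->
  ProperFilter (within [set s | R3H s /\ theta_den s != 0] (nbhs t)).
Proof.
move=> tH; split; last exact: within_filter.
rewrite /within /= => near_singular.
(* The direction (0, 1, -1) of the plane is transversal to all three families
of singular lines. *)
pose v : 'rV[R]_3 := \row_j (if j == 0 then 0 else if j == 1 then 1 else -1).
have path : (t + e *: v @[e --> 0^'+] --> t).
  have : (t + e *: v @[e --> 0^'+] --> t + (0 : R) *: v).
    apply: cvg_at_right_filter; apply: cvgD; first exact: cvg_cst.
    by apply: cvgZ; [exact: cvg_id|exact: cvg_cst].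
  by rewrite scale0r addr0.
have {near_singular path} sing : \forall e \near (0 : R)^'+,
    ~ (R3H (t + e *: v) /\ theta_den (t + e *: v) != 0).
  exact: path _ near_singular.
have coord (e : R) (i : 'I_3) : (t + e *: v) 0 i = t 0 i + e * v 0 i.
  by rewrite !mxE.
have [v0 v1 v2] : [/\ v 0 0 = 0, v 0 1 = 1 & v 0 2 = -1] by rewrite !mxE.
have pi0 : pi != 0 :> R by rewrite gt_eqF ?pi_gt0.
have c1 : - pi / 3 != 0 :> R.
  by rewrite mulf_neq0 ?oppr_eq0// invr_eq0 pnatr_eq0.
have c2 : 2 * pi / 3 != 0 :> R.
  by rewrite !mulf_neq0// ?invr_eq0 pnatr_eq0.
near (0 : R)^'+ => e.
suff : R3H (t + e *: v) /\ theta_den (t + e *: v) != 0 by near: e; exact: sing.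
split; first by rewrite /R3H /= !coord v0 v1 v2; move: tH; rewrite /R3H /=; lra.
rewrite /theta_den !coord v0 v1 v2.
have -> : pi * (t 0 0 + e * 0 - (t 0 1 + e * 1)) / 3
  = pi * (t 0 0 - t 0 1) / 3 + (- pi / 3) * e by ring.
have -> : pi * (t 0 1 + e * 1 - (t 0 2 + e * -1)) / 3
  = pi * (t 0 1 - t 0 2) / 3 + (2 * pi / 3) * e by ring.
have -> : pi * (t 0 2 + e * -1 - (t 0 0 + e * 0)) / 3
  = pi * (t 0 2 - t 0 0) / 3 + (- pi / 3) * e by ring.
rewrite !mulf_neq0//; near: e; exact: near_sin_affine_neq0.
Unshelve. all: by end_near. Qed.

Lemma Theta_hexU (R : realType) (m : int) (N : nat) (t : 'rV[R]_3) :
  m + 1 = N%:Z -> R3H t -> Theta m t = hexU N t.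
Proof.
move=> mN tH; rewrite /Theta.
have quot (s : 'rV[R]_3) : theta_den s != 0 ->
    theta_num m s / theta_den s = hexU N s.
  by move=> s0; rewrite (theta_num_hexU _ mN) mulrC mulKf.
case: ifPn => [/quot //|_].
have := R3H_within_regular tH => PF.
apply: cvg_lim; first exact: Rhausdorff.
have lim_hexU :
    hexU N s @[s --> within [set s | R3H s /\ theta_den s != 0] (nbhs t)] --> hexU N t.
  exact: (@cvg_within_filter _ _ _ (nbhs t) _ (nbhs (hexU N t)) _
    (@continuous_hexU R N t)).
apply: cvg_trans lim_hexU; apply: near_eq_cvg.
by apply: filterS (withinT _ (nbhs_filter t)) => s [_ s0]; rewrite quot.
Qed.

Lemma Theta_continuous (R : realType) (m : int) (N : nat) :
  m + 1 = N%:Z -> {within @R3H R, continuous (@Theta R m)}.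
Proof.
move=> mN; apply: (@subspace_eq_continuous _ _ _ (@hexU R N)).
  by move=> t; rewrite inE => tH; apply/esym; exact: Theta_hexU.
exact/continuous_subspaceT/continuous_hexU.
Qed.

(** * Sums of exponentials over the hexagon *)

Local Open Scope complex_scope.

Definition expi (R : realType) (x : R) : R[i] := cos x +i* sin x.

Lemma expiE (R : realType) (x : R) : expi x = (cos x)%:C + 'i * (sin x)%:C.
Proof. by rewrite [LHS]complexE. Qed.

Lemma expiD (R : realType) (x y : R) : expi (x + y) = expi x * expi y.
Proof. by rewrite /expi cosD sinD; simpc; congr (_ +i* _); ring. Qed.

Lemma expi_addN (R : realType) (x : R) : expi x + expi (- x) = (2 * cos x)%:C.
Proof. by rewrite /expi cosN sinN; simpc; congr (_ +i* _); ring. Qed.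

Lemma phiE (R : realType) (j : 'rV[int]_3) (t : 'rV[R]_3) :
  phi j t = expi (2 * pi / 3 * dotp j t).
Proof. by rewrite /phi /cexp expR0 !mul1r. Qed.

(** The imaginary part vanishes by the symmetry k |-> N - 1 - k. *)
Lemma chebU_expi (R : realType) (N : nat) (x : R) :
  (chebU N x)%:C = \sum_(k \in `I_N) expi ((N%:R - 1 - 2 * k%:R) * x).
Proof.
rewrite -(fsbig_ord _ _ (fun k => expi ((N%:R - 1 - 2 * k%:R) * x))).
rewrite (eq_bigr _ (fun k _ => expiE _)) big_split /= -mulr_sumr -!rmorph_sum /=.
suff -> : \sum_(k < N) sin ((N%:R - 1 - 2 * k%:R) * x) = 0.
  by rewrite mulr0 addr0.
set s := LHS; suff : s = - s by lra.
rewrite {1}/s (reindex_inj rev_ord_inj) /= -sumrN; apply: eq_bigr => k _.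
rewrite -sinN; congr sin.
by rewrite natrB // -natr1; ring.
Qed.

Definition vec3 (a b c : int) : 'rV[int]_3 := \row_i [:: a; b; c]`_i.

Lemma vec3P (j : 'rV[int]_3) (a b c : int) :
  j = vec3 a b c <-> [/\ j 0 0 = a, j 0 1 = b & j 0 2 = c].
Proof.
split=> [->|[ja jb jc]]; first by rewrite !mxE.
apply/rowP => i; rewrite mxE.
case: i => -[|[|[|//]]] Hi /=; rewrite -?ja -?jb -?jc; congr (j 0 _); exact/val_inj.
Qed.

Lemma vec3E (a b c : int) :
  (vec3 a b c 0 0 = a) * (vec3 a b c 0 1 = b) * (vec3 a b c 0 2 = c).
Proof. by rewrite !mxE. Qed.

Lemma sum3E (V : nmodType) (F : 'I_3 -> V) : \sum_(i < 3) F i = F 0 + F 1 + F 2.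
Proof.
rewrite !big_ord_recr big_ord0 /= add0r.
by congr (F _ + F _ + F _); exact/val_inj.
Qed.

Lemma forall3P (P : 'I_3 -> Prop) : (forall i, P i) <-> [/\ P 0, P 1 & P 2].
Proof.
split=> [//|[p0 p1 p2] [[|[|[|//]]] Hi]].
- by have -> : Ordinal Hi = 0 by exact/val_inj.
- by have -> : Ordinal Hi = 1 by exact/val_inj.
- by have -> : Ordinal Hi = 2 by exact/val_inj.
Qed.

(** The frequency of the summand indexed by (a, b, c) in the expansion of
[hexU]: -2 (a A + b B + c C) is 2 pi / 3 times its scalar product with t. *)
Definition cyc (p : nat * nat * nat) : 'rV[int]_3 :=
  vec3 (p.2%:Z - p.1.1%:Z) (p.1.1%:Z - p.1.2%:Z) (p.1.2%:Z - p.2%:Z).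

Definition cube (N : nat) : set (nat * nat * nat) := `I_N `*` `I_N `*` `I_N.

Lemma finite_cube (N : nat) : finite_set (cube N).
Proof. by rewrite /cube; do !apply: finite_setX. Qed.

Lemma hexU_cube (R : realType) (N : nat) (t : 'rV[R]_3) : R3H t ->
  (hexU N t)%:C = \sum_(p \in cube N) phi (cyc p) t.
Proof.
move=> tH; rewrite /hexU !rmorphM /= !chebU_expi.
rewrite mulr_fsuml; under eq_fsbigr do rewrite mulr_fsumr.
rewrite pair_fsbig//= mulr_fsuml; under eq_fsbigr do rewrite mulr_fsumr.
rewrite pair_fsbig//=; last exact: finite_setX.
apply: eq_fsbigr => -[[a b] c] _ /=.
rewrite -!expiD phiE; congr expi.
rewrite /dotp sum3E !vec3E /=.
have -> : t 0 2 = - (t 0 0 + t 0 1) by move: tH; rewrite /R3H /=; lra.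
by rewrite !intrB -!pmulrn; field.
Qed.

Lemma HstarP (n : nat) (j : 'rV[int]_3) : Hstar n j <->
  [/\ j 0 0 + j 0 1 + j 0 2 = 0, - n%:Z <= j 0 0 <= n%:Z,
      - n%:Z <= j 0 1 <= n%:Z & - n%:Z <= j 0 2 <= n%:Z].
Proof.
split=> [[jH /forall3P[]]//|[jH j0 j1 j2]].
by split=> //; apply/forall3P.
Qed.

Lemma HcircP (n : nat) (j : 'rV[int]_3) : Hcirc n j <->
  [/\ j 0 0 + j 0 1 + j 0 2 = 0, - n%:Z < j 0 0 < n%:Z,
      - n%:Z < j 0 1 < n%:Z & - n%:Z < j 0 2 < n%:Z].
Proof.
split=> [[jH /forall3P[]]//|[jH j0 j1 j2]].
by split=> //; apply/forall3P.
Qed.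

Lemma Hcirc_Hstar (n : nat) : (1 <= n)%N -> Hcirc n = Hstar n.-1.
Proof.
move=> hn; apply/seteqP; split=> j.
  by move/HcircP => [? ? ? ?]; apply/HstarP; split; lia.
by move/HstarP => [? ? ? ?]; apply/HcircP; split; lia.
Qed.

Definition shell (n : nat) := cube n.+1 `\` cube n.

(** A triple is determined by its differences and its largest entry, and the
differences are bounded by n when the largest entry is n. *)
Lemma shell_bij (n : nat) : set_bij (shell n) (Hstar n) cyc.
Proof.
split.
- move=> [[a b] c] [[[/= ha hb] hc] _]; apply/HstarP; rewrite !vec3E /=.
  by split; lia.
- move=> [[a b] c] [[a' b'] c']; rewrite !inE.
  move=> -[[[/= ha hb] hc] h] [[[/= ha' hb'] hc'] h'].
  move/vec3P; rewrite !vec3E /= => -[e1 e2 e3].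
  have {}h : ~ [/\ (a < n)%N, (b < n)%N & (c < n)%N].
    by move=> [? ? ?]; apply: h.
  have {}h' : ~ [/\ (a' < n)%N, (b' < n)%N & (c' < n)%N].
    by move=> [? ? ?]; apply: h'.
  have [? ? ?] : [/\ a = a', b = b' & c = c'].
    have : (a = n \/ b = n \/ c = n)%N.
      have [|?] := ltnP a n; have [|?] := ltnP b n; have [|?] := ltnP c n; try lia.
      by move=> ? ? ?; case: h.
    have : (a' = n \/ b' = n \/ c' = n)%N.
      have [|?] := ltnP a' n; have [|?] := ltnP b' n; have [|?] := ltnP c' n; try lia.
      by move=> ? ? ?; case: h'.
    by move=> *; split; lia.
  by congr (_, _, _).
- move=> j /HstarP [j0 j1 j2 j3].
  (* Since a - c = - j 0 0 and b - c = j 0 2, [m] is the amount by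
  which the largest of a, b, c exceeds c. *)
  pose m : int := Num.max 0 (Num.max (- j 0 0) (j 0 2)).
  have hm : 0 <= m <= n%:Z /\ - j 0 0 <= m /\ j 0 2 <= m /\
    (m = 0 \/ m = - j 0 0 \/ m = j 0 2).
    rewrite /m; case: (ltP (- j 0 0) (j 0 2)) => ?; case: ltP => ?; lia.
  have [c hc] : exists c : nat, c%:Z = n%:Z - m.
    by exists (absz (n%:Z - m)%R); lia.
  have [a ha] : exists a : nat, a%:Z = n%:Z - m - j 0 0.
    by exists (absz (n%:Z - m - j 0 0)%R); lia.
  have [b hb] : exists b : nat, b%:Z = n%:Z - m + j 0 2.
    by exists (absz (n%:Z - m + j 0 2)%R); lia.
  exists (a, b, c).
    split; first by split; [split|] => /=; lia.
    move=> [[/= ? ?] ?]; lia.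
  by apply/esym/vec3P => /=; split; lia.
Qed.

Lemma finite_Hstar (n : nat) : finite_set (Hstar n).
Proof.
have [_ _ cycS] := shell_bij n; apply: sub_finite_set cycS _.
exact/finite_image/finite_setD/finite_cube.
Qed.

(** The Dirichlet kernel of the hexagon: the shell of triples with largest entry
n is the difference of two consecutive cubes. *)
Lemma sum_phi_Hstar (R : realType) (n : nat) (t : 'rV[R]_3) : R3H t ->
  \sum_(j \in Hstar n) phi j t = (hexU n.+1 t - hexU n t)%:C.
Proof.
move=> tH; rewrite (reindex_fsbig cyc (shell n)); last exact: shell_bij.
rewrite rmorphB /= !hexU_cube//; apply/eqP; rewrite -subr_eq opprK; apply/eqP.
rewrite -fsbigU0//=.
- rewrite setUC /shell setDUK//.
  by move=> [[a b] c] [[/= ? ?] ?]; split; [split|] => /=; lia.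
- exact/finite_setD/finite_cube.
- exact: finite_cube.
- by move=> p [[_ ?] ?].
Qed.

(** * The compact formula *)

Lemma vec3_eq (a b c a' b' c' : int) :
  (vec3 a b c == vec3 a' b' c') = [&& a == a', b == b' & c == c'].
Proof.
apply/eqP/and3P => [/vec3P|[/eqP -> /eqP -> /eqP ->]//].
by rewrite !vec3E => -[-> -> ->].
Qed.

Definition vertices (n : nat) : seq 'rV[int]_3 :=
  [:: vec3 n%:Z (- n%:Z) 0; vec3 (- n%:Z) n%:Z 0; vec3 0 n%:Z (- n%:Z);
      vec3 0 (- n%:Z) n%:Z; vec3 (- n%:Z) 0 n%:Z; vec3 n%:Z 0 (- n%:Z)].

Lemma vertices_uniq (n : nat) : (1 <= n)%N -> uniq (vertices n).
Proof.
move=> hn; rewrite /= !inE !vec3_eq.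
have [n1 n2] : (n%:Z == 0) = false /\ (0 == n%:Z) = false by lia.
have [n3 n4] : (- n%:Z == 0) = false /\ (0 == - n%:Z) = false by lia.
have [n5 n6] : (n%:Z == - n%:Z) = false /\ (- n%:Z == n%:Z) = false by lia.
by rewrite !(n1, n2, n3, n4, n5, n6) /= ?andbF.
Qed.

Lemma vec3_eta (j : 'rV[int]_3) : j = vec3 (j 0 0) (j 0 1) (j 0 2).
Proof. exact/vec3P. Qed.

(** A boundary point with a zero coordinate has the other two equal to n
and -n. *)
Lemma verticesP (n : nat) (j : 'rV[int]_3) : (1 <= n)%N ->
  (j \in vertices n) = (j \in Hbound n) && (j 0 0 * j 0 1 * j 0 2 == 0).
Proof.
move=> hn; apply/idP/andP.
  rewrite !inE => /orP[|/orP[|/orP[|/orP[|/orP[|]]]]] /eqP ->; rewrite !vec3E;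
    (split; last by rewrite ?mulr0 ?mul0r); split;
    try (by apply/HstarP; rewrite !vec3E; split; lia);
    by move/HcircP; rewrite !vec3E => -[? ? ? ?]; lia.
rewrite inE => -[[/HstarP[h0 h1 h2 h3] hC]].
have {}hC : ~ (- n%:Z < j 0 0 < n%:Z /\ - n%:Z < j 0 1 < n%:Z /\
              - n%:Z < j 0 2 < n%:Z).
  by move=> [? [? ?]]; apply: hC; apply/HcircP.
rewrite !mulf_eq0 => /orP[/orP[]|] /eqP hz.
- have [e|e] : j 0 1 = n%:Z \/ j 0 1 = - n%:Z by lia.
    have -> : j = vec3 0 n%:Z (- n%:Z) by apply/vec3P; split; lia.
    by rewrite !inE eqxx ?orbT.
  have -> : j = vec3 0 (- n%:Z) n%:Z by apply/vec3P; split; lia.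
  by rewrite !inE eqxx ?orbT.
- have [e|e] : j 0 2 = n%:Z \/ j 0 2 = - n%:Z by lia.
    have -> : j = vec3 (- n%:Z) 0 n%:Z by apply/vec3P; split; lia.
    by rewrite !inE eqxx ?orbT.
  have -> : j = vec3 n%:Z 0 (- n%:Z) by apply/vec3P; split; lia.
  by rewrite !inE eqxx ?orbT.
- have [e|e] : j 0 0 = n%:Z \/ j 0 0 = - n%:Z by lia.
    have -> : j = vec3 n%:Z (- n%:Z) 0 by apply/vec3P; split; lia.
    by rewrite !inE eqxx ?orbT.
  have -> : j = vec3 (- n%:Z) n%:Z 0 by apply/vec3P; split; lia.
  by rewrite !inE eqxx ?orbT.
Qed.

(** The decomposition of the weights behind the compact formula: on the edges
1/2, at the vertices 1/2 - 1/6 = 1/3. *)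
Lemma weightE (R : realType) (n : nat) (j : 'rV[int]_3) :
  (1 <= n)%N -> Hstar n j ->
  weight R n j = 1 / 2 + (if j \in Hcirc n then 1 / 2 else 0)
    - (if j \in [set` vertices n] then 1 / 6 else 0).
Proof.
move=> hn jS.
have -> : (j \in [set` vertices n]) = (j \in vertices n) by rewrite mem_setE.
rewrite verticesP // /weight.
have -> : (j \in Hbound n) = (j \notin Hcirc n).
  apply/idP/idP; first by rewrite inE => -[_ h]; rewrite notin_setE.
  by rewrite notin_setE => h; rewrite in_setE.
case: (j \in Hcirc n) => /=; first by field.
by case: eqP => _ /=; field.
Qed.

Lemma phi_vec3 (R : realType) (a b c : int) (t : 'rV[R]_3) :
  phi (vec3 a b c) t =
  expi (2 * pi / 3 * (a%:~R * t 0 0 + b%:~R * t 0 1 + c%:~R * t 0 2)).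
Proof. by rewrite phiE /dotp sum3E !vec3E. Qed.

Definition cos3 (R : realType) (n : nat) (t : 'rV[R]_3) : R :=
  cos (2 * n%:R * pi / 3 * (t 0 0 - t 0 1))
  + cos (2 * n%:R * pi / 3 * (t 0 1 - t 0 2))
  + cos (2 * n%:R * pi / 3 * (t 0 2 - t 0 0)).

(** Opposite vertices carry conjugate exponentials. *)
Lemma sum_phi_vertices (R : realType) (n : nat) (t : 'rV[R]_3) : (1 <= n)%N ->
  \sum_(j \in [set` vertices n]) phi j t = (2 * cos3 n t)%:C.
Proof.
move=> hn; rewrite -fsbig_seq ?vertices_uniq// /vertices !big_cons big_nil /= addr0.
have pair (a b c : int) (x : R) :
    a%:~R * t 0 0 + b%:~R * t 0 1 + c%:~R * t 0 2 = n%:R * x ->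
    phi (vec3 a b c) t + phi (vec3 (- a) (- b) (- c)) t
    = (2 * cos (2 * n%:R * pi / 3 * x))%:C.
  move=> abc; rewrite -expi_addN !phi_vec3; congr (expi _ + expi _).
    by rewrite abc; ring.
  have -> : 2 * n%:R * pi / 3 * x = 2 * pi / 3 * (n%:R * x) by ring.
  by rewrite -abc !mulrNz; ring.
rewrite addrA [phi (vec3 0 n _) t + _]addrA.
have := @pair n%:Z (- n%:Z) 0 (t 0 0 - t 0 1); rewrite opprK oppr0 => ->; last first.
  by rewrite mulrNz mulr0z -pmulrn; ring.
have := @pair 0 n%:Z (- n%:Z) (t 0 1 - t 0 2); rewrite opprK oppr0 => ->; last first.
  by rewrite mulrNz mulr0z -pmulrn; ring.
have := @pair (- n%:Z) 0 n%:Z (t 0 2 - t 0 0); rewrite opprK oppr0 => ->; last first.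
  by rewrite mulrNz mulr0z -pmulrn; ring.
by rewrite -!rmorphD /= /cos3; congr (_%:C); ring.
Qed.

Lemma sum_weight_phi (R : realType) (n : nat) (t : 'rV[R]_3) :
  (1 <= n)%N -> R3H t ->
  \sum_(j \in Hstar n) (weight R n j)%:C * phi j t =
  (1 / 2 * (hexU n.+1 t - hexU n.-1 t) - 1 / 3 * cos3 n t)%:C.
Proof.
move=> hn tH.
have fH := finite_Hstar n.
transitivity (\sum_(j \in Hstar n) ((1 / 2)%:C * phi j t +
   ((1 / 2)%:C * (if j \in Hcirc n then phi j t else 0) +
   (- (1 / 6))%:C * (if j \in [set` vertices n] then phi j t else 0)))).
  apply: eq_fsbigr => j; rewrite inE => jS; rewrite weightE//.
  by case: ifP => _; case: ifP => _;
    rewrite ?rmorphB ?rmorphD ?rmorph0 ?rmorphN /=; ring.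
rewrite fsbig_split//= fsbig_split//= -!mulr_fsumr -!fsbig_mkcondr.
have -> : Hstar n `&` Hcirc n = Hstar n.-1.
  rewrite Hcirc_Hstar// setIC; apply/setIidPl.
  by rewrite -Hcirc_Hstar// => j /HcircP[? ? ? ?]; apply/HstarP; split; lia.
have -> : Hstar n `&` [set` vertices n] = [set` vertices n].
  rewrite setIC; apply/setIidPl => j /=; rewrite verticesP// => /andP[].
  by rewrite inE => -[].
rewrite !sum_phi_Hstar// sum_phi_vertices// prednK// -!rmorphM -!rmorphD /=.
by congr (_%:C); field.
Qed.

Lemma Phistar_hexU (R : realType) (n : nat) (t : 'rV[R]_3) :
  (1 <= n)%N -> R3H t ->
  Phistar n t = ((3 * n%:R ^+ 2)^-1 *
    (1 / 2 * (hexU n.+1 t - hexU n.-1 t) - 1 / 3 * cos3 n t))%:C.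
Proof.
move=> hn tH; rewrite /Phistar sum_weight_phi// rmorphM /=; congr (_ * _).
by rewrite fmorphV rmorphM rmorphXn /= !rmorph_nat.
Qed.

(** * Interpolation *)

Lemma dotpD (R : realType) (j : 'rV[int]_3) (t s : 'rV[R]_3) :
  dotp j (t + s) = dotp j t + dotp j s.
Proof. by rewrite /dotp -big_split /=; apply: eq_bigr => i _; rewrite mxE mulrDr. Qed.

Lemma phiD (R : realType) (j : 'rV[int]_3) (t s : 'rV[R]_3) :
  phi j (t + s) = phi j t * phi j s.
Proof. by rewrite !phiE dotpD mulrDr expiD. Qed.

(** Each phi_k is a character, so the translates of the kernel stay in the
span. *)
Lemma interp_in_Hspan (R : realType) (n : nat) (f : 'rV[R]_3 -> R[i]) :
  in_Hspan n (interp n f).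
Proof.
exists (fun k => \sum_(j \in Hstar n)
   f (node R n j) * ((3 * n%:R ^+ 2)^-1 *
     ((weight R n k)%:C * phi k (- node R n j)))).
move=> t _; have fH := finite_Hstar n.
under [RHS]eq_fsbigr do rewrite mulr_fsuml.
rewrite exchange_fsbig//; apply: eq_fsbigr => j _.
rewrite /ell /Phistar !mulr_fsumr; apply: eq_fsbigr => k _.
by rewrite phiD; ring.
Qed.

Lemma sin_pi3_eq0 (R : realType) (d : R) :
  sin (pi * d / 3) = 0 <-> exists m : int, d = 3 * m%:~R.
Proof.
have pi0 : pi != 0 :> R by rewrite gt_eqF ?pi_gt0.
split=> [/eqP/sin_eq0P [m E]|[m ->]].
  by exists m; apply: (mulfI pi0); lra.
by apply/eqP/sin_eq0P; exists m; field.
Qed.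

(** The removable singularities of all three factors of [hexU] meet exactly at
the points congruent to 0 modulo 3. *)
Lemma eqmod3P (R : realType) (t s : 'rV[R]_3) : eqmod3 t s <->
  [&& sin (pi * ((t - s) 0 0 - (t - s) 0 1) / 3) == 0,
      sin (pi * ((t - s) 0 1 - (t - s) 0 2) / 3) == 0 &
      sin (pi * ((t - s) 0 2 - (t - s) 0 0) / 3) == 0].
Proof.
rewrite !mxE; split=> [h|/and3P[]].
  by apply/and3P; split; apply/eqP/sin_pi3_eq0; exact: h.
move=> /eqP/sin_pi3_eq0 h0 /eqP/sin_pi3_eq0 h1 /eqP/sin_pi3_eq0 h2.
have opp (x y : R) : (exists m : int, x - y = 3 * m%:~R) ->
    exists m : int, y - x = 3 * m%:~R.
  by move=> [m E]; exists (- m); rewrite mulrNz mulrN -E opprB.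
have refl (x : R) : exists m : int, x - x = 3 * m%:~R.
  by exists 0; rewrite mulr0 subrr.
by apply/forall3P; split; apply/forall3P; split => //; exact: opp.
Qed.

Lemma R3H_node (R : realType) (n : nat) (j : 'rV[int]_3) :
  HH j -> R3H (node R n j).
Proof.
by rewrite /HH /R3H /= !mxE -!mulrDl -!intrD => ->; rewrite mul0r.
Qed.

Lemma R3HB (R : realType) (t s : 'rV[R]_3) : R3H t -> R3H s -> R3H (t - s).
Proof. by rewrite /R3H /= !mxE; lra. Qed.

(** The discrete orthogonality of the exponentials on the nodes. *)
Lemma Phistar_node (R : realType) (n : nat) (j k : 'rV[int]_3) : (1 <= n)%N ->
  HH j -> HH k ->
  Phistar n (node R n j - node R n k) =
  if `[< eqmod3 (node R n k) (node R n j) >] then 1 else 0.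
Proof.
move=> hn jH kH; set t := _ - _.
have n0 : n%:R != 0 :> R by rewrite pnatr_eq0 -lt0n.
have tH : R3H t by apply: R3HB; exact: R3H_node.
have coord i : n%:R * t 0 i = (j 0 i - k 0 i)%:~R.
  by rewrite !mxE intrB; field.
have rest : j 0 0 - k 0 0 = - (j 0 1 - k 0 1) - (j 0 2 - k 0 2).
  have jH' : j 0 0 + j 0 1 + j 0 2 = 0 := jH.
  have kH' : k 0 0 + k 0 1 + k 0 2 = 0 := kH.
  by lia.
rewrite Phistar_hexU// /hexU.
(* Applied with d - d' = - 3 (j - k)_i / n. *)
have jump (d d' : R) (m : int) : n%:R * (d - d') = (3 * m)%:~R ->
    sin (n%:R * (pi * d / 3) - n%:R * (pi * d' / 3)) = 0.
  move=> E; apply/eqP/sin_eq0P; exists m.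
  transitivity (pi * (n%:R * (d - d')) / 3); first by ring.
  by rewrite E intrM; field.
have cosE (d : R) : cos (2 * n%:R * pi / 3 * d) = cos (2 * (n%:R * (pi * d / 3))).
  by congr cos; ring.
rewrite /cos3 !cosE node_kernel//.
- have sym : eqmod3 (node R n k) (node R n j) <-> eqmod3 (node R n j) (node R n k).
    by split=> h i l; have [m E] := h i l; exists (- m);
      rewrite mulrNz mulrN -E; ring.
  have -> : `[< eqmod3 (node R n k) (node R n j) >] =
     [&& sin (pi * (t 0 0 - t 0 1) / 3) == 0, sin (pi * (t 0 1 - t 0 2) / 3) == 0
       & sin (pi * (t 0 2 - t 0 0) / 3) == 0].
    by apply/asboolP/idP; rewrite sym => /eqmod3P.
  case: ifP => _; last by rewrite mulr0.
  by rewrite mulVf// mulf_neq0// expf_neq0.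
- by ring.
- apply: (jump _ _ (- (j 0 1 - k 0 1))).
  transitivity (n%:R * t 0 0 - 2 * (n%:R * t 0 1) + n%:R * t 0 2); first by ring.
  rewrite !coord.
  rewrite rest.
  by rewrite !(intrM, intrB, mulrNz); ring.
- apply: (jump _ _ (- (j 0 2 - k 0 2))).
  transitivity (n%:R * t 0 1 - 2 * (n%:R * t 0 2) + n%:R * t 0 0); first by ring.
  rewrite !coord.
  rewrite rest.
  by rewrite !(intrM, intrB, mulrNz); ring.
Qed.

Lemma interp_node (R : realType) (n : nat) (f : 'rV[R]_3 -> R[i])
    (j : 'rV[int]_3) : (1 <= n)%N -> HH j ->
  interp n f (node R n j) = \sum_(k \in Sset R n j) f (node R n k).
Proof.
move=> hn jH.
have -> : Sset R n j = Hstar n `&` [set k | eqmod3 (node R n k) (node R n j)] by [].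
rewrite fsbig_mkcondr; apply: eq_fsbigr => k; rewrite inE => -[kH _].
rewrite /ell Phistar_node//; case: asboolP => h.
  by rewrite mulr1 mem_set.
by rewrite mulr0 memNset.
Qed.

(** If k is congruent to j, then k - j is n (u, v, w) with u + v + w = 0 and
u, v, w congruent to one another modulo 3; for interior j the entries lie in
{-1, 0, 1}, hence they are equal, hence 0. *)
Lemma Sset_interior (R : realType) (n : nat) (j : 'rV[int]_3) : (1 <= n)%N ->
  Hcirc n j -> Sset R n j = [set j].
Proof.
move=> hn /HcircP [jH j0 j1 j2]; apply/seteqP; split=> k; last first.
  move=> ->; split; first by apply/HstarP; split=> //; lia.
  by move=> i l; exists 0; rewrite !subrr mulr0.
move=> [/HstarP[kH k0 k1 k2] kj].
have n0 : n%:R != 0 :> R by rewrite pnatr_eq0 -lt0n.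
have diff i l : exists m : int,
    (k 0 i - j 0 i) - (k 0 l - j 0 l) = 3 * n%:Z * m.
  have [m] := kj i l; rewrite !mxE => E; exists m.
  apply: (@intr_inj R); rewrite !(intrM, intrB) -pmulrn.
  rewrite [3 * _]mulrC -mulrA -E; field.
  by [].
have [m hm] := diff 0 1; have [m' hm'] := diff 1 2.
have e0 : k 0 0 - j 0 0 = n%:Z * (2 * m + m') by lia.
have e1 : k 0 1 - j 0 1 = n%:Z * (m' - m) by lia.
have e2 : k 0 2 - j 0 2 = n%:Z * (- m - 2 * m') by lia.
have small (u : int) : - (2 * n%:Z) < n%:Z * u < 2 * n%:Z -> -1 <= u <= 1.
  by move=> h; nia.
have b0 : -1 <= 2 * m + m' <= 1 by apply: small; lia.
have b1 : -1 <= m' - m <= 1 by apply: small; lia.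
have b2 : -1 <= - m - 2 * m' <= 1 by apply: small; lia.
have [mz m'z] : m = 0 /\ m' = 0 by lia.
rewrite /= [k]vec3_eta [j]vec3_eta; congr vec3; [move: e0|move: e1|move: e2];
  rewrite mz m'z; lia.
Qed.
Local Close Scope complex_scope.
Unset Implicit Arguments.

Theorem theorem3p5 (R : realType) (n : nat) (hn : (1 <= n)%N) :
  (forall f : 'rV[R]_3 -> R[i]^o,
     {within @hexagon R, continuous f} ->
     [/\ in_Hspan n (interp n f),
         (forall j, Hcirc n j -> interp n f (node R n j) = f (node R n j))
       & (forall j, Hbound n j ->
            interp n f (node R n j) = \sum_(k \in Sset R n j) f (node R n k))]) /\
  (forall t : 'rV[R]_3, R3H t -> Phistar n t \is Num.real) /\
  ({within @R3H R, continuous (@Theta R n%:Z)} /\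
   {within @R3H R, continuous (@Theta R (n%:Z - 2))}) /\
  (forall t : 'rV[R]_3, R3H t ->
     Phistar n t = real_complex R
       ((3 * n%:R ^+ 2)^-1 *
        (1 / 2 * (Theta n%:Z t - Theta (n%:Z - 2) t)
         - 1 / 3 * (cos (2 * n%:R * pi / 3 * (t 0 0 - t 0 1))
                    + cos (2 * n%:R * pi / 3 * (t 0 1 - t 0 2))
                    + cos (2 * n%:R * pi / 3 * (t 0 2 - t 0 0)))))).
Proof.
have idx : n%:Z + 1 = n.+1%:Z by lia.
have idx2 : n%:Z - 2 + 1 = n.-1%:Z by lia.
split; [|split; [|split; [|]]].
- move=> f _; split.
  + exact: interp_in_Hspan.
  + move=> j jC; rewrite interp_node//; last by case: jC.
    by rewrite Sset_interior// fsbig_set1.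
  + by move=> j [[jH _] _]; exact: interp_node.
- by move=> t tH; rewrite Phistar_hexU// complex_real.
- by split; [exact: Theta_continuous idx|exact: Theta_continuous idx2].
- by move=> t tH; rewrite Phistar_hexU// (Theta_hexU idx tH) (Theta_hexU idx2 tH).
Qed.
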